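(* Let $N\ge 1$, let $y=(y_1,\dots,y_N)\in\mathbb{R}^N$ and $\tilde y=(\tilde y_1,\dots,\tilde y_N)\in\mathbb{R}^N$, let $\mathcal{S}\subseteq\{1,\dots,N\}$, and let $R:=\max_{i,j\in\{1,\dots,N\}}|y_i-y_j|$, assumed to satisfy $R>0$. Let $\varepsilon,\eta,\delta$ be real numbers with $\eta\ge 0$. Assume: 1. (Anchor accuracy) For all $i\in\mathcal{S}$, $|\tilde y_i-y_i|\le\varepsilon$. 2. (Two-sided coverage) For each $j\in\{1,\dots,N\}\setminus\mathcal{S}$, the nearest anchors $i^-(j),i^+(j)\in\mathcal{S}$ below and above $y_j$ (as defined in the context) exist, so that $y_{i^-(j)}\le y_j\le y_{i^+(j)}$, and they satisfy $|y_j-y_{i^-(j)}|\le\eta$ and $|y_j-y_{i^+(j)}|\le\eta$. 3. (Max-hinge control) The anchored ranking loss satisfies $L_{\mathrm{anchor}}(y,\tilde y)\le\delta$. Then the maximum pointwise error $E:=\max_{j\in\{1,\dots,N\}}|\tilde y_j-y_j|$ satisfies $$E\le \varepsilon+\eta+R\,\delta.$$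
   Context: Here $y$ is the vector of labels (mean opinion scores) of a mini-batch of size $N$, $\tilde y$ is the vector of model predictions, and $\mathcal{S}$ is the set of anchor indices. Write $(t)_+:=\max\{0,t\}$. For each non-anchor index $j\notin\mathcal{S}$, nearest anchors are (arbitrary) choices $$i^-(j)\in\arg\max_{i\in\mathcal{S}:\,y_i\le y_j} y_i,\qquad i^+(j)\in\arg\min_{i\in\mathcal{S}:\,y_i\ge y_j} y_i .$$ The one-sided ranking violations are $$v_j^+:=(\tilde y_j-\tilde y_{i^+(j)})_+,\qquad v_j^-:=(\tilde y_{i^-(j)}-\tilde y_j)_+ .$$ The per-sample loss and the anchored ranking loss are $$\ell^{\mathrm{near}}_j:=\frac{1}{R}\max\{v_j^+,v_j^-\},\qquad L_{\mathrm{anchor}}(y,\tilde y):=\max_{j\notin\mathcal{S}}\ell^{\mathrm{near}}_j,$$ where the maximum over the empty set (when every index is an anchor) is taken to be $0$. *)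

(* Defs.v *)
From HB Require Import structures.
From mathcomp Require Import all_boot all_order all_algebra.
From mathcomp Require Import reals.

Set Implicit Arguments.
Unset Strict Implicit.
Unset Printing Implicit Defensive.

Import Order.TTheory GRing.Theory Num.Theory.

Local Open Scope ring_scope.

(* The real line is an arbitrary [realType].
   All the maxima below are maxima of families of nonnegative reals, so the
   neutral element 0 of the iterated [Num.max] does not affect the value of a
   maximum over a nonempty family. Only [anchor_loss] may range over an empty
   family, and its value is then 0 by convention. *)

Definition pos_part (K : realType) (t : K) : K := Num.max 0 t.

Definition label_range (K : realType) (N : nat) (y : 'rV[K]_N) : K :=
  \big[Num.max/0]_(i < N) \big[Num.max/0]_(j < N) `|y 0 i - y 0 j|.

Definition max_error (K : realType) (N : nat) (y yt : 'rV[K]_N) : K :=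
  \big[Num.max/0]_(j < N) `|yt 0 j - y 0 j|.

Definition nearest_below (K : realType) (N : nat) (y : 'rV[K]_N)
    (S : {set 'I_N}) (j i : 'I_N) : Prop :=
  [/\ i \in S, y 0 i <= y 0 j &
      forall k : 'I_N, k \in S -> y 0 k <= y 0 j -> y 0 k <= y 0 i].

Definition nearest_above (K : realType) (N : nat) (y : 'rV[K]_N)
    (S : {set 'I_N}) (j i : 'I_N) : Prop :=
  [/\ i \in S, y 0 j <= y 0 i &
      forall k : 'I_N, k \in S -> y 0 j <= y 0 k -> y 0 i <= y 0 k].

(* Ties are possible, so the nearest anchors are given by choice functions
   im (below) and ip (above). These are total on the indices, but only their
   values outside S are used. *)

Definition viol_above (K : realType) (N : nat) (yt : 'rV[K]_N)
    (ip : 'I_N -> 'I_N) (j : 'I_N) : K :=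
  pos_part (yt 0 j - yt 0 (ip j)).

Definition viol_below (K : realType) (N : nat) (yt : 'rV[K]_N)
    (im : 'I_N -> 'I_N) (j : 'I_N) : K :=
  pos_part (yt 0 (im j) - yt 0 j).

Definition near_loss (K : realType) (N : nat) (y yt : 'rV[K]_N)
    (im ip : 'I_N -> 'I_N) (j : 'I_N) : K :=
  1 / label_range y * Num.max (viol_above yt ip j) (viol_below yt im j).

Definition anchor_loss (K : realType) (N : nat) (y yt : 'rV[K]_N)
    (S : {set 'I_N}) (im ip : 'I_N -> 'I_N) : K :=
  \big[Num.max/0]_(j < N | j \notin S) near_loss y yt im ip j.

(* Main.v *)
(** A non-anchor prediction exceeds the prediction at the nearest anchor above
    by at most [R * delta]; that anchor's prediction exceeds its label by at most
    [eps], and its label exceeds [y_j] by at most [eta]. The anchor below gives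
    the lower bound in the same way. *)

Require Import Defs.
From HB Require Import structures.
From mathcomp Require Import all_boot all_order all_algebra.
From mathcomp Require Import reals lra.

Set Implicit Arguments.
Unset Strict Implicit.
Unset Printing Implicit Defensive.

Import Order.TTheory GRing.Theory Num.Theory.

Local Open Scope ring_scope.

Lemma near_loss_le_anchor_loss (K : realType) (N : nat) (y yt : 'rV[K]_N)
    (S : {set 'I_N}) (im ip : 'I_N -> 'I_N) (j : 'I_N) :
  j \notin S -> near_loss y yt im ip j <= anchor_loss y yt S im ip.
Proof.
by move=> jS; apply: (le_bigmax_cond _ (fun j => near_loss y yt im ip j)).
Qed.

Lemma anchor_loss_ge0 (K : realType) (N : nat) (y yt : 'rV[K]_N)
    (S : {set 'I_N}) (im ip : 'I_N -> 'I_N) :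
  0 <= anchor_loss y yt S im ip.
Proof. exact: bigmax_ge_id. Qed.

(** Since [label_range y] is positive, the factor [1 / label_range y] can be cleared; a bound on a
    maximum of positive parts then bounds both signed differences. *)
Lemma near_loss_le (K : realType) (N : nat) (y yt : 'rV[K]_N)
    (im ip : 'I_N -> 'I_N) (j : 'I_N) (delta : K) :
  0 < label_range y -> near_loss y yt im ip j <= delta ->
  yt 0 j - yt 0 (ip j) <= label_range y * delta /\
  yt 0 (im j) - yt 0 j <= label_range y * delta.
Proof.
move=> R_gt0; rewrite /near_loss mul1r ler_pdivrMl // ge_max.
by rewrite /viol_above /viol_below /pos_part !ge_max
  => /andP[/andP[_ ->] /andP[_ ->]].
Qed.

Theorem theorem1 (K : realType) (N : nat) (y yt : 'rV[K]_N) (S : {set 'I_N})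
    (im ip : 'I_N -> 'I_N) (eps eta delta : K)
    (hN : (1 <= N)%N)
    (hR : 0 < label_range y)
    (heta : 0 <= eta)
    (anchor_accuracy : forall i : 'I_N, i \in S -> `|yt 0 i - y 0 i| <= eps)
    (coverage : forall j : 'I_N, j \notin S ->
      [/\ nearest_below y S j (im j), nearest_above y S j (ip j),
          `|y 0 j - y 0 (im j)| <= eta & `|y 0 j - y 0 (ip j)| <= eta])
    (max_hinge : anchor_loss y yt S im ip <= delta) :
  max_error y yt <= eps + eta + label_range y * delta.
Proof.
(* The sign of [delta] comes from the loss, a maximum started at 0. It matters at anchors, where the
   error is at most [eps] and the remaining terms must be nonnegative. *)
have delta_ge0 : 0 <= delta := le_trans (anchor_loss_ge0 _ _ _ _ _) max_hinge.
have Rdelta_ge0 : 0 <= label_range y * delta by rewrite mulr_ge0 // ltW.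
have pointwise j : `|yt 0 j - y 0 j| <= eps + eta + label_range y * delta.
  have [jS|jS] := boolP (j \in S); first by have := anchor_accuracy j jS; lra.
  have [[imS _ _] [ipS _ _]] := coverage j jS.
  have := anchor_accuracy _ imS; have := anchor_accuracy _ ipS.
  have [] := near_loss_le hR
    (le_trans (near_loss_le_anchor_loss y yt im ip jS) max_hinge).
  rewrite !ler_norml => above below /andP[? ?] /andP[? ?] /andP[? ?] /andP[? ?].
  by apply/andP; split; lra.
(* The default value 0 of the maximum must also lie below the bound. As [eps] has no assumed sign,
   this is read off from the error at the first index, which exists by [hN]. *)
apply: bigmax_le => [|j _]; last exact: pointwise.
exact: le_trans (normr_ge0 _) (pointwise (Ordinal hN)).
Qed.
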